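(* Let $\mathfrak{g}=2\mathfrak{g}_{2,1}$. A three-dimensional subspace $\mathfrak{q}\subset\mathfrak{g}$ generates $\mathfrak{g}$ if and only if $\dim(\mathfrak{q}\cap\mathfrak{J})=1$ for every two-dimensional ideal $\mathfrak{J}$ of the Lie algebra $\mathfrak{g}$. There exist two equivalence classes of such subspaces; $\mathfrak{q}$ belongs to the first (respectively, the second) equivalence class if $\mathfrak{q}$ contains one (respectively, contains no) one-dimensional ideal of $\mathfrak{g}$.
   Context: $2\mathfrak{g}_{2,1}$ is the four-dimensional real Lie algebra with basis $E_1,\dots,E_4$ and nonzero commutators $[E_1,E_2]=E_1$, $[E_3,E_4]=E_3$ (up to antisymmetry). A subspace generates $\mathfrak{g}$ if the smallest Lie subalgebra containing it is $\mathfrak{g}$. Two subspaces are equivalent if one is the image of the other under an automorphism of the Lie algebra $\mathfrak{g}$. *)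

(* Defs.v *)
From HB Require Import structures.
From mathcomp Require Import all_boot all_order all_algebra.
From mathcomp Require Import ring.
From mathcomp Require Import boolp classical_sets reals.
Set Implicit Arguments.
Unset Strict Implicit.
Unset Printing Implicit Defensive.
Import GRing.Theory.
Local Open Scope ring_scope.

HB.mixin Record Vector_isLieAlgebra (R : fieldType) V of Vector R V := {
  lie : V -> V -> V;
  lie_linearl : forall y, linear (lie^~ y);
  lie_linearr : forall x, linear (lie x);
  liexx : forall x, lie x x = 0;
  lie_jacobi : forall x y z,
    lie x (lie y z) + lie y (lie z x) + lie z (lie x y) = 0
}.

#[short(type="lieAlgType")]
HB.structure Definition LieAlgebra (R : fieldType) :=
  {V of Vector_isLieAlgebra R V & Vector R V}.

Section LieAlgebraNotions.
Variables (R : fieldType) (g : lieAlgType R).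
Implicit Types U h q : {vspace g}.

Definition is_subalgebra h : Prop :=
  forall x y, x \in h -> y \in h -> lie x y \in h.

(* By antisymmetry of the bracket, one-sided ideals are two-sided. *)
Definition is_ideal h : Prop :=
  forall x y, x \in h -> lie x y \in h.

Definition is_smallest_subalgebra_containing U h : Prop :=
  [/\ is_subalgebra h, (U <= h)%VS &
      forall h', is_subalgebra h' -> (U <= h')%VS -> (h <= h')%VS].

Definition generates q : Prop := is_smallest_subalgebra_containing q fullv.

Definition is_automorphism (f : 'End(g)) : Prop :=
  bijective f /\ forall x y, f (lie x y) = lie (f x) (f y).

Definition equivalent_subspaces q q' : Prop :=
  exists2 f : 'End(g), is_automorphism f & (f @: q)%VS = q'.

Definition equivalence_class q : set {vspace g} :=
  [set q' | equivalent_subspaces q q']%classic.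

Definition contained_line_ideal q U : Prop :=
  [/\ is_ideal U, \dim U = 1%N & (U <= q)%VS].

End LieAlgebraNotions.

Definition two_g21 (R : realType) : Type := 'rV[R]_4.
HB.instance Definition _ (R : realType) :=
  Vector.copy (two_g21 R) 'rV[R]_4.

Section TwoG21.
Variable R : realType.
Implicit Types x y z : two_g21 R.

(* Zero-based indices: the basis vector usually written E_(i+1) is E i. *)
Definition E (i : 'I_4) : two_g21 R := delta_mx 0 i.

(* The bilinear alternating extension of [E_1, E_2] = E_1, [E_3, E_4] = E_3. *)
Definition two_g21_lie x y : two_g21 R :=
  (x 0 (inord 0) * y 0 (inord 1) - x 0 (inord 1) * y 0 (inord 0)) *: E (inord 0)
  + (x 0 (inord 2) * y 0 (inord 3) - x 0 (inord 3) * y 0 (inord 2))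
    *: E (inord 2).

Let lieE x y (j : 'I_4) : two_g21_lie x y 0 j =
  (x 0 (inord 0) * y 0 (inord 1) - x 0 (inord 1) * y 0 (inord 0))
    * (j == inord 0)%:R
  + (x 0 (inord 2) * y 0 (inord 3) - x 0 (inord 3) * y 0 (inord 2))
    * (j == inord 2)%:R.
Proof. by rewrite !mxE. Qed.

Let inordE m n : (m < 4)%N -> (n < 4)%N ->
  ((inord m : 'I_4) == inord n) = (m == n).
Proof. by move=> mlt nlt; rewrite -val_eqE /= !inordK. Qed.

Fact two_g21_lie_linearl y : linear (two_g21_lie^~ y).
Proof. by move=> a u v; apply/rowP => j; rewrite !(lieE, mxE) /=; ring. Qed.

Fact two_g21_lie_linearr x : linear (two_g21_lie x).
Proof. by move=> a u v; apply/rowP => j; rewrite !(lieE, mxE) /=; ring. Qed.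

Fact two_g21_liexx x : two_g21_lie x x = 0.
Proof. by apply/rowP => j; rewrite lieE mxE; ring. Qed.

Fact two_g21_lie_jacobi x y z :
  two_g21_lie x (two_g21_lie y z) + two_g21_lie y (two_g21_lie z x)
  + two_g21_lie z (two_g21_lie x y) = 0.
Proof.
apply/rowP => j; rewrite [LHS]mxE [X in X + _]mxE [RHS]mxE !lieE !inordE //=.
by ring.
Qed.

HB.instance Definition _ := Vector_isLieAlgebra.Build R (two_g21 R)
  two_g21_lie_linearl two_g21_lie_linearr two_g21_liexx two_g21_lie_jacobi.

Lemma lie_EE (i j : 'I_4) : (i < j)%N ->
  lie (E i) (E j) =
    if (i == 0%N :> nat) && (j == 1%N :> nat) then E i
    else if (i == 2%N :> nat) && (j == 3%N :> nat) then E i else 0.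
Proof.
move=> ij; apply/rowP => k; rewrite [LHS]lieE !mxE -!val_eqE /= !inordK //.
case: i ij => [[|[|[|[|?]]]] ?] //; case: j => [[|[|[|[|?]]]] ?] // _ /=;
  rewrite !mxE -?val_eqE /=; ring.
Qed.

Lemma E_basis : basis_of fullv [tuple E i | i < 4].
Proof.
rewrite basisEdim dimvf size_tuple leqnn andbT.
apply/subvP => x _; rewrite [x]row_sum_delta; apply: memv_suml => i _.
apply/memvZ/memv_span/map_f; exact: mem_enum.
Qed.

End TwoG21.

Definition generating_hyperplane (R : realType) (q : {vspace two_g21 R}) : Prop :=
  \dim q = 3%N /\ generates q.

(* Main.v *)
(* A hyperplane generates iff it is not a subalgebra. Writing q as the kernel of
   the covector (a, b, c, d), q is a subalgebra iff the 2-form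
   a e^1 /\ e^2 + c e^3 /\ e^4 vanishes on q, that is iff its wedge product with
   the covector is zero: ac = ad = bc = 0. This says that q contains one of the
   ideals <E1, E2>, <E3, E4>, <E1, E3>. The only one-dimensional ideals are <E1>
   and <E3>, so q contains one iff ac = 0. The automorphisms E1 |-> s E1,
   E2 |-> E2 + t E1, E3 |-> u E3, E4 |-> E4 + v E3 and the exchange of the two
   factors bring the covector of a generating hyperplane to (0, 1, 1, 0) if
   ac = 0 and to (1, 0, 1, 0) otherwise. *)
Require Import Defs.
From HB Require Import structures.
From mathcomp Require Import all_boot all_order all_algebra.
From mathcomp Require Import ring.
From mathcomp Require Import boolp classical_sets reals.
Set Implicit Arguments.
Unset Strict Implicit.
Unset Printing Implicit Defensive.
Import GRing.Theory.
Local Open Scope ring_scope.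

(** * Transport along automorphisms, and hyperplanes of a general Lie algebra *)

Section Automorphisms.
Variables (K : fieldType) (g : lieAlgType K).
Implicit Types (U q h J : {vspace g}) (f : 'End(g)).

Lemma automorphism_comp f1 f2 :
  is_automorphism f1 -> is_automorphism f2 -> is_automorphism (f1 \o f2)%VF.
Proof.
move=> [b1 m1] [b2 m2]; split; last by move=> x y; rewrite !comp_lfunE m2 m1.
by apply: (eq_bij (bij_comp b1 b2)) => x /=; rewrite comp_lfunE.
Qed.

Lemma automorphism_inv f : is_automorphism f ->
  [/\ is_automorphism f^-1%VF, cancel f f^-1%VF & cancel f^-1%VF f].
Proof.
move=> [bf mf]; have kf : lker f == 0%VS by apply/lker0P/bij_inj.
have fK := lker0_lfunK kf; have Kf := lker0_lfunVK kf.
split=> //; split; first by exists f.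
by move=> x y; apply: (bij_inj bf); rewrite mf !Kf.
Qed.

Lemma equivalent_sym U q : equivalent_subspaces U q -> equivalent_subspaces q U.
Proof.
move=> [f af <-]; have [aV fK _] := automorphism_inv af.
exists (f^-1)%VF => //; rewrite -limg_comp -[RHS]lim1g.
by congr (_ @: _)%VS; apply/lfunP => x; rewrite comp_lfunE fK id_lfunE.
Qed.

Lemma equivalent_trans U V W : @equivalent_subspaces K g U V ->
  equivalent_subspaces V W -> equivalent_subspaces U W.
Proof.
move=> [f1 a1 <-] [f2 a2 <-]; exists (f2 \o f1)%VF; first exact: automorphism_comp.
by rewrite limg_comp.
Qed.

Lemma equivalent_dim U q : equivalent_subspaces U q -> \dim q = \dim U.
Proof.
move=> [f [bf _] <-]; apply: limg_dim_eq.
have /eqP -> : lker f == 0%VS by apply/lker0P/bij_inj.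
exact: capv0.
Qed.

Lemma limg_subalgebra f h :
  is_automorphism f -> is_subalgebra h -> is_subalgebra (f @: h).
Proof.
move=> [_ mf] sh x' y' /memv_imgP [x xh ->] /memv_imgP [y yh ->].
by rewrite -mf memv_img // sh.
Qed.

Lemma limg_ideal f h : is_automorphism f -> is_ideal h -> is_ideal (f @: h).
Proof.
move=> af ih x' y /memv_imgP [x xh ->].
have [_ _ Kf] := automorphism_inv af.
(* The second argument of the bracket ranges over the whole algebra, so it is first written as an
   image under [f], which is onto. *)
by rewrite -[y]Kf -af.2 memv_img // ih.
Qed.

Lemma equivalent_subalgebra U q :
  equivalent_subspaces U q -> is_subalgebra U -> is_subalgebra q.
Proof. by move=> [f af <-]; apply: limg_subalgebra. Qed.

Lemma equivalent_line_ideal U q : equivalent_subspaces U q ->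
  (exists I, contained_line_ideal U I) -> exists I, contained_line_ideal q I.
Proof.
move=> [f af <-] [I [iI dI sI]]; exists (f @: I)%VS; split.
- exact: limg_ideal.
- by rewrite (@equivalent_dim I) //; exists f.
- exact: limgS.
Qed.

(** No subspace lies strictly between a hyperplane and the whole algebra, so a subalgebra containing
    [q] is either [q] or everything. *)
Lemma generates_hyperplane q : (\dim q).+1 = \dim {:g} ->
  generates q <-> ~ is_subalgebra q.
Proof.
move=> dq; split=> [[_ _ min] sq | nsq].
  by have /dimvS := min q sq (subvv _); rewrite -dq ltnn.
split; [by move=> *; exact: memvf | exact: subvf | move=> h sh qh].
have qnh : q != h by apply/eqP => qh'; apply: nsq; rewrite qh'.
have: (\dim q < \dim h)%N.
  rewrite ltn_neqAle dimvS // andbT; apply: contra qnh.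
  by move=> /eqP e; rewrite eqEdim qh e leqnn.
rewrite dq => dh; suff /eqP <- : h == fullv by [].
by rewrite eqEdim subvf.
Qed.

(** Write [q = J + <[v]>]. In a bracket of two elements of [q], every term involves an element of
    the ideal [J], except a multiple of [lie v v], which is zero. *)
Lemma codim1_ideal_subalgebra J q : is_ideal J -> (J <= q)%VS ->
  \dim q = (\dim J).+1 -> is_subalgebra q.
Proof.
move=> iJ Jq dq.
have [v vq vJ] : exists2 v, v \in q & v \notin J.
  apply/subvPn; apply/negP => /dimvS; by rewrite dq ltnn.
have qE : q = (J + <[v]>)%VS.
  apply/esym/eqP; rewrite eqEdim subv_add Jq -memvE vq /= dq.
  rewrite dimv_disjoint_sum ?dim_vline; last first.
    apply/eqP; rewrite -subv0; apply/subvP => x.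
    rewrite memv_cap => /andP [xJ /vlineP [k xE]].
    have [k0|k0] := eqVneq k 0; first by rewrite xE k0 scale0r mem0v.
    by move: xJ; rewrite xE rpredZeq (negPf k0) (negPf vJ).
  have -> : v != 0 by apply: contraNneq vJ => ->; exact: mem0v.
  by rewrite addn1.
(* Antisymmetry comes from expanding [lie (x + y) (x + y) = 0]. *)
have lN (x y : g) : lie x y = - lie y x.
  apply/eqP; rewrite -addr_eq0; have := liexx (x + y).
  have Dl (a b c : g) : lie (a + b) c = lie a c + lie b c.
    by have := lie_linearl c 1 a b; rewrite /= !scale1r.
  have Dr (a b c : g) : lie c (a + b) = lie c a + lie c b.
    by have := lie_linearr c 1 a b; rewrite !scale1r.
  by rewrite Dl !Dr !liexx add0r addr0 => ->.
have lD (a b c : g) k : lie (a + k *: b) c = lie a c + k *: lie b c.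
  have := lie_linearl c k b a; rewrite /= => e.
  by rewrite addrC e addrC.
have lDr (a b c : g) k : lie c (a + k *: b) = lie c a + k *: lie c b.
  by rewrite addrC lie_linearr addrC.
move=> x y; rewrite {1 2}qE => /memv_addP [j jJ [_ /vlineP [k ->] ->]].
move=> /memv_addP [j' jJ' [_ /vlineP [k' ->] ->]].
apply: (subvP Jq); rewrite lD memvD ?iJ // memvZ // lDr liexx scaler0 addr0.
by rewrite lN rpredN iJ.
Qed.

(** Since [q + J] is strictly larger than the hyperplane [q], it is the whole space; the dimension
    formula for sums and intersections does the rest. *)
Lemma dim_hyperplane_cap q J : (\dim q).+1 = \dim {:g} -> \dim J = 2%N ->
  ~~ (J <= q)%VS -> \dim (q :&: J)%VS = 1%N.
Proof.
move=> dq dJ nJq; have := dimv_sum_cap q J.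
have -> : \dim (q + J)%VS = \dim {:g}.
  apply/eqP; rewrite eqn_leq dimvS ?subvf //= -dq ltn_neqAle dimvS ?addvSl //.
  rewrite andbT; apply: contra nJq => /eqP e.
  have /eqP -> : q == (q + J)%VS by rewrite eqEdim addvSl e leqnn.
  exact: addvSr.
by rewrite dJ -dq addSn -addnS => /addnI [].
Qed.

End Automorphisms.

(** * Coordinates, and hyperplanes as kernels of covectors *)

Section TwoG21Hyperplanes.
Variable R : realType.
Implicit Types (x y : two_g21 R) (q : {vspace two_g21 R}) (a b c d : R).

Definition vec a b c d : two_g21 R := \row_(j < 4) [:: a; b; c; d]`_j.

Definition form a b c d x : R :=
  a * x 0 (inord 0) + b * x 0 (inord 1) + c * x 0 (inord 2) + d * x 0 (inord 3).

(** A relation, because a hyperplane fixes its covector only up to a nonzero factor. The zero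
    covector is allowed and describes the whole space. *)
Definition kernel_of q a b c d := forall x, (x \in q) = (form a b c d x == 0).

Lemma vecE a b c d : (vec a b c d 0 (inord 0) = a) * (vec a b c d 0 (inord 1) = b)
  * (vec a b c d 0 (inord 2) = c) * (vec a b c d 0 (inord 3) = d).
Proof. by rewrite !mxE !inordK. Qed.

Lemma vec_eta x :
  x = vec (x 0 (inord 0)) (x 0 (inord 1)) (x 0 (inord 2)) (x 0 (inord 3)).
Proof.
apply/rowP => j; rewrite [RHS]mxE; case: j => [[|[|[|[|?]]]] ?] //=;
  by congr (x 0 _); apply: val_inj; rewrite /= inordK.
Qed.

Lemma vec_inj x y :
  x 0 (inord 0) = y 0 (inord 0) -> x 0 (inord 1) = y 0 (inord 1) ->
  x 0 (inord 2) = y 0 (inord 2) -> x 0 (inord 3) = y 0 (inord 3) -> x = y.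
Proof. by move=> *; rewrite [x]vec_eta [y]vec_eta; congr vec. Qed.

Lemma scale_vec k a b c d :
  k *: vec a b c d = vec (k * a) (k * b) (k * c) (k * d).
Proof. by apply: vec_inj; rewrite vecE !mxE !inordK. Qed.

Lemma lie_vec x y : lie x y =
  vec (x 0 (inord 0) * y 0 (inord 1) - x 0 (inord 1) * y 0 (inord 0)) 0
      (x 0 (inord 2) * y 0 (inord 3) - x 0 (inord 3) * y 0 (inord 2)) 0.
Proof.
change (lie x y) with (two_g21_lie x y).
apply: vec_inj; rewrite vecE /two_g21_lie /E !mxE -!val_eqE /= ?inordK //=;
  by rewrite ?mulr1 ?mulr0 ?addr0 ?add0r.
Qed.

Lemma dim_two_g21 : \dim {: two_g21 R} = 4%N.
Proof. by rewrite dimvf. Qed.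

Lemma form_linear a b c d : linear (form a b c d : two_g21 R -> R^o).
Proof. by move=> k x y; rewrite /form !mxE /GRing.scale /=; ring. Qed.

Lemma form_vec a b c d k0 k1 k2 k3 :
  form a b c d (vec k0 k1 k2 k3) = a * k0 + b * k1 + c * k2 + d * k3.
Proof. by rewrite /form !vecE. Qed.

Lemma linear_form (f : two_g21 R -> R) :
  (forall k x y, f (k *: x + y) = k * f x + f y) ->
  f =1 form (f (vec 1 0 0 0)) (f (vec 0 1 0 0)) (f (vec 0 0 1 0))
            (f (vec 0 0 0 1)).
Proof.
move=> lf x; have f0 : f 0 = 0.
  by have := lf (-1) 0 0; rewrite scaler0 addr0 mulN1r addNr.
rewrite {1}(_ : x = x 0 (inord 0) *: vec 1 0 0 0 + (x 0 (inord 1) *: vec 0 1 0 0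
   + (x 0 (inord 2) *: vec 0 0 1 0 + (x 0 (inord 3) *: vec 0 0 0 1 + 0)))).
  by rewrite !lf f0 /form; ring.
by apply: vec_inj; rewrite !mxE !inordK //=; ring.
Qed.

(** The endomorphism [\1 - projv q] has kernel [q] and a one-dimensional image; reading off a
    nonzero coordinate [j] of a generator [w] of that image turns it into a covector. *)
Lemma hyperplane_kernel q :
  \dim q = 3%N -> exists a b c d, kernel_of q a b c d.
Proof.
move=> dq; pose f : 'End(two_g21 R) := (\1 - projv q)%VF.
have fE x : (x \in q) = (f x == 0).
  rewrite add_lfunE opp_lfunE id_lfunE subr_eq0; apply/idP/eqP => [xq | ->].
    by rewrite projv_id.
  exact: memv_proj.
have df : \dim (limg f) = 1%N.
  have := limg_ker_dim f fullv; rewrite capfv dim_two_g21.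
  suff -> : lker f = q by rewrite dq => -[].
  by apply/vspaceP => x; rewrite memv_ker fE.
pose w := vpick (limg f).
have w0 : w != 0 by rewrite vpick0 -dimv_eq0 df.
have /rV0Pn [j wj] := w0.
have limgE : limg f = <[w]>%VS.
  apply/esym/eqP; rewrite eqEdim df dim_vline w0 andbT.
  by rewrite -memvE memv_pick.
exists (f (vec 1 0 0 0) 0 j), (f (vec 0 1 0 0) 0 j), (f (vec 0 0 1 0) 0 j),
  (f (vec 0 0 0 1) 0 j) => x.
rewrite -(@linear_form (fun x => f x 0 j)); last first.
  by move=> k y z; rewrite linearP !mxE.
have : f x \in limg f by rewrite memv_img ?memvf.
rewrite fE limgE => /vlineP [k ->].
by rewrite mxE scaler_eq0 mulf_eq0 (negPf w0) (negPf wj).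
Qed.

(** The vector [x] witnesses that the form is nonzero, hence of rank one, and rank-nullity gives the
    dimension of its kernel. *)
Lemma kernel_hyperplane a b c d x : form a b c d x != 0 ->
  exists2 q, \dim q = 3%N & kernel_of q a b c d.
Proof.
move=> nx.
pose F := GRing.isLinear.Build R (two_g21 R) R^o _ _ (form_linear a b c d).
pose f : {linear two_g21 R -> R^o} := HB.pack (form a b c d) F.
have mem : kernel_of (lker (linfun f)) a b c d.
  by move=> y; rewrite memv_ker lfunE.
exists (lker (linfun f)) => //.
have := limg_ker_dim (linfun f) fullv; rewrite capfv dim_two_g21.
suff -> : \dim (limg (linfun f)) = 1%N by rewrite addn1 => -[].
apply/eqP; rewrite eqn_leq; apply/andP; split.
  by apply: leq_trans (dimvS (subvf _)) _; rewrite dimvf.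
rewrite lt0n dimv_eq0; apply: contra nx => /eqP e.
by have := memv_img (linfun f) (memvf x); rewrite e memv0 lfunE.
Qed.

(** * Which covectors define subalgebras *)

Lemma kernel_subalgebra q a b c d : kernel_of q a b c d ->
  is_subalgebra q <-> [/\ a * c = 0, a * d = 0 & b * c = 0].
Proof.
move=> qE; split=> [sq | [ac ad bc] x y].
  have k x y : form a b c d x = 0 -> form a b c d y = 0 ->
      form a b c d (lie x y) = 0.
    by move=> /eqP; rewrite -qE => xq /eqP; rewrite -qE => yq;
       apply/eqP; rewrite -qE sq.
  (* The test vectors are the contractions of the covector with E_i /\ E_j. *)
  split; apply/eqP.
  - have := k (vec b (- a) 0 0) (vec c 0 (- a) 0).
    rewrite lie_vec !form_vec !vecE => /(_ ltac:(ring) ltac:(ring)).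
    (* The form takes on the bracket the wanted product times one of its own factors, so the product
       vanishes in a field. The next two cases go the same way. *)
    rewrite (_ : _ + _ = a * (a * c)); last by ring.
    by move/eqP; rewrite !mulf_eq0 orbA orbb.
  - have := k (vec b (- a) 0 0) (vec d 0 0 (- a)).
    rewrite lie_vec !form_vec !vecE => /(_ ltac:(ring) ltac:(ring)).
    rewrite (_ : _ + _ = a * (a * d)); last by ring.
    by move/eqP; rewrite !mulf_eq0 orbA orbb.
  - have := k (vec 0 0 d (- c)) (vec 0 (- c) b 0).
    rewrite lie_vec !form_vec !vecE => /(_ ltac:(ring) ltac:(ring)).
    rewrite (_ : _ + _ = c * (b * c)); last by ring.
    by move/eqP; rewrite !mulf_eq0 orbCA orbb.
rewrite !qE lie_vec form_vec => /eqP + /eqP; rewrite /form.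
set x0 := x 0 _; set x1 := x 0 _; set x2 := x 0 _; set x3 := x 0 _.
set y0 := y 0 _; set y1 := y 0 _; set y2 := y 0 _; set y3 := y 0 _ => fx fy.
(* Three cases arise: if [a = c = 0] the form kills every bracket; if [a = b = 0] or [c = d = 0] its
   value on the bracket is a combination of its values at [x] and [y]. *)
apply/eqP; move/eqP: ac; rewrite mulf_eq0 => /orP [] /eqP z.
  move/eqP: bc; rewrite mulf_eq0 => /orP [] /eqP z'; last by rewrite z z'; ring.
  rewrite z z' !mul0r !add0r in fx fy *.
  by transitivity (y3 * (c * x2 + d * x3) - x3 * (c * y2 + d * y3));
    [ring | rewrite fx fy; ring].
move/eqP: ad; rewrite mulf_eq0 => /orP [] /eqP z'; first by rewrite z z'; ring.
rewrite z z' !mul0r !addr0 in fx fy *.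
by transitivity (y1 * (a * x0 + b * x1) - x1 * (a * y0 + b * y1));
  [ring | rewrite fx fy; ring].
Qed.

(** * One-dimensional ideals *)

(** Brackets of a generator [v] with basis vectors isolate its coordinates: [[v, E1]] and [[v, E3]]
    are [-v_1 E1] and [-v_3 E3] (coordinates counted from 0). If both vanish, [[v, E2] = v_0 E1],
    and if this vanishes too, [v] is a multiple of [E3]. *)
Lemma line_ideal_vec I : is_ideal I -> \dim I = 1%N ->
  I = <[vec 1 0 0 0]>%VS \/ I = <[vec 0 0 1 0]>%VS.
Proof.
move=> iI dI.
have line e k : k != 0 -> k *: e \in I -> e != 0 -> I = <[e]>%VS.
  move=> k0; rewrite rpredZeq (negPf k0) /= => eI e0.
  by apply/esym/eqP; rewrite eqEdim dI dim_vline e0 andbT -memvE.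
have line0 k : k != 0 -> vec k 0 0 0 \in I -> I = <[vec 1 0 0 0]>%VS.
  move=> k0 kI; apply: (line _ k) => //.
    by rewrite scale_vec mulr1 mulr0.
  apply/eqP => /rowP /(_ (inord 0)) /eqP.
  by rewrite !mxE !inordK //= oner_eq0.
have line2 k : k != 0 -> vec 0 0 k 0 \in I -> I = <[vec 0 0 1 0]>%VS.
  move=> k0 kI; apply: (line _ k) => //.
    by rewrite scale_vec mulr1 mulr0.
  apply/eqP => /rowP /(_ (inord 2)) /eqP.
  by rewrite !mxE !inordK //= oner_eq0.
pose v := vpick I; have vI : v \in I by exact: memv_pick.
have v0 : v != 0 by rewrite vpick0 -dimv_eq0 dI.
have bracket y := iI v y vI.
have [z1 | n1] := eqVneq (v 0 (inord 1)) 0; last first.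
  left; apply: (line0 (- v 0 (inord 1))); first by rewrite oppr_eq0.
  by have := bracket (vec 1 0 0 0);
    rewrite lie_vec !vecE !(mulr0, mulr1, subr0, sub0r, oppr0).
have [z3 | n3] := eqVneq (v 0 (inord 3)) 0; last first.
  right; apply: (line2 (- v 0 (inord 3))); first by rewrite oppr_eq0.
  by have := bracket (vec 0 0 1 0);
    rewrite lie_vec !vecE !(mulr0, mulr1, subr0, sub0r, oppr0).
have [z0 | n0] := eqVneq (v 0 (inord 0)) 0; last first.
  left; apply: (line0 (v 0 (inord 0))) => //.
  by have := bracket (vec 0 1 0 0);
    rewrite lie_vec !vecE !(mulr0, mulr1, subr0, sub0r, oppr0).
right; apply: (line2 (v 0 (inord 2))); last first.
  by have := vI; rewrite {1}[v]vec_eta z0 z1 z3.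
apply: contra v0 => /eqP z2; apply/eqP; rewrite [v]vec_eta z0 z1 z2 z3.
by apply: vec_inj; rewrite !mxE !inordK.
Qed.

Lemma line_vec_ideal :
  (is_ideal <[vec 1 0 0 0]>%VS /\ \dim <[vec 1 0 0 0]>%VS = 1%N) /\
  (is_ideal <[vec 0 0 1 0]>%VS /\ \dim <[vec 0 0 1 0]>%VS = 1%N).
Proof.
have n0 : vec 1 0 0 0 != 0.
  apply/eqP => /rowP /(_ (inord 0)) /eqP.
  by rewrite !mxE !inordK //= oner_eq0.
have n2 : vec 0 0 1 0 != 0.
  apply/eqP => /rowP /(_ (inord 2)) /eqP.
  by rewrite !mxE !inordK //= oner_eq0.
rewrite !dim_vline n0 n2; split; split=> // x' x /vlineP [l ->];
  rewrite lie_vec !mxE !inordK //=; apply/vlineP.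
  by exists (l * x 0 (inord 1)); apply: vec_inj; rewrite !mxE !inordK //=; ring.
by exists (l * x 0 (inord 3)); apply: vec_inj; rewrite !mxE !inordK //=; ring.
Qed.

(** The numbers [a] and [c] are the values of the form at the generators of the two lines. *)
Lemma kernel_line_ideal q a b c d : kernel_of q a b c d ->
  (contained_line_ideal q <[vec 1 0 0 0]>%VS <-> a = 0) /\
  (contained_line_ideal q <[vec 0 0 1 0]>%VS <-> c = 0).
Proof.
move=> qE; have [[i0 d0] [i2 d2]] := line_vec_ideal.
have m0 : (<[vec 1 0 0 0]> <= q)%VS = (a == 0).
  by rewrite -memvE qE form_vec !mulr0 mulr1 !addr0.
have m2 : (<[vec 0 0 1 0]> <= q)%VS = (c == 0).
  by rewrite -memvE qE form_vec !mulr0 mulr1 !addr0 !add0r.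
by rewrite /contained_line_ideal m0 m2; split; split=> [[_ _ /eqP] | ->].
Qed.

Lemma kernel_contains_line_ideal q a b c d : kernel_of q a b c d ->
  (exists I, contained_line_ideal q I) <-> a * c = 0.
Proof.
move=> qE; have [k0 k2] := kernel_line_ideal qE; split.
  move=> [I H]; have [iI dI _] := H.
  by case: (line_ideal_vec iI dI) => IE; move: H; rewrite IE;
    [move/k0 | move/k2] => ->; rewrite ?mul0r ?mulr0.
move=> /eqP; rewrite mulf_eq0 => /orP [] /eqP.
  by move=> /k0; exists <[vec 1 0 0 0]>%VS.
by move=> /k2; exists <[vec 0 0 1 0]>%VS.
Qed.

(** * Covectors of generating hyperplanes and their line ideals *)

Lemma generating_kernel q : generating_hyperplane q ->
  exists a b c d, kernel_of q a b c d /\ ~ [/\ a * c = 0, a * d = 0 & b * c = 0].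
Proof.
move=> [dq]; rewrite generates_hyperplane ?dq ?dim_two_g21 // => nsq.
have [a [b [c [d qE]]]] := hyperplane_kernel dq.
by exists a, b, c, d; split=> //; rewrite -(kernel_subalgebra qE).
Qed.

Lemma kernel_generating q a b c d : \dim q = 3%N -> kernel_of q a b c d ->
  ~ [/\ a * c = 0, a * d = 0 & b * c = 0] -> generating_hyperplane q.
Proof.
move=> dq qE nz; split=> //.
by rewrite generates_hyperplane ?dq ?dim_two_g21 // (kernel_subalgebra qE).
Qed.

(** Containing both line ideals would force [a = c = 0], which makes [q] a subalgebra. *)
Lemma unique_line_ideal q : generating_hyperplane q ->
  (exists I, contained_line_ideal q I) <-> exists! I, contained_line_ideal q I.
Proof.
move=> gq; split=> [[I qI] | [I [qI _]]]; last by exists I.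
exists I; split=> // J qJ.
have [a [b [c [d [qE nz]]]]] := generating_kernel gq.
have [k0 k2] := kernel_line_ideal qE.
have [[iI dI _] [iJ dJ _]] := (qI, qJ).
have absurd : ~ (a = 0 /\ c = 0).
  by move=> [a0 c0]; apply: nz; rewrite a0 c0 !mulr0 !mul0r.
move: qI qJ.
by case: (line_ideal_vec iI dI) (line_ideal_vec iJ dJ) => -> [] -> //;
  [move=> /k0 ? /k2 ? | move=> /k2 ? /k0 ?]; case: absurd.
Qed.

(** * Explicit automorphisms *)

Lemma automorphism_equivalent (f g : two_g21 R -> two_g21 R) q q' :
  linear f -> cancel f g -> cancel g f ->
  (forall x y, f (lie x y) = lie (f x) (f y)) ->
  (forall x, (f x \in q') = (x \in q)) -> equivalent_subspaces q q'.
Proof.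
move=> lf fK gK mf fq.
pose F := GRing.isLinear.Build R (two_g21 R) (two_g21 R) _ _ lf.
pose f' : {linear two_g21 R -> two_g21 R} := HB.pack f F.
have fE x : linfun f' x = f x by rewrite lfunE.
exists (linfun f').
  split; last by move=> x y; rewrite !fE.
  by exists g => x; rewrite fE.
apply/vspaceP => y; apply/memv_imgP/idP => [[x xq ->] | yq'].
  by rewrite fE fq.
by exists (g y); rewrite ?fE ?gK // -fq gK.
Qed.

(** The map pulls the covector of [q'] back to [(a' s, b' + a' t, c' u, d' + c' v)]; the factor [l]
    accounts for proportional covectors having the same kernel. *)
Lemma triangular_equivalent q q' a b c d a' b' c' d' l s t u v :
  kernel_of q a b c d -> kernel_of q' a' b' c' d' ->
  l != 0 -> s != 0 -> u != 0 ->
  a' * s = l * a -> b' + a' * t = l * b -> c' * u = l * c -> d' + c' * v = l * d ->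
  equivalent_subspaces q q'.
Proof.
move=> qE qE' l0 s0 u0 ea eb ec ed.
apply: (@automorphism_equivalent
  (fun x => vec (s * x 0 (inord 0) + t * x 0 (inord 1)) (x 0 (inord 1))
                (u * x 0 (inord 2) + v * x 0 (inord 3)) (x 0 (inord 3)))
  (fun x => vec ((x 0 (inord 0) - t * x 0 (inord 1)) / s) (x 0 (inord 1))
                ((x 0 (inord 2) - v * x 0 (inord 3)) / u) (x 0 (inord 3)))).
- by move=> k x y; apply: vec_inj; rewrite !mxE ?inordK //=; ring.
- by move=> x; apply: vec_inj; rewrite !vecE //; field.
- by move=> x; apply: vec_inj; rewrite !vecE //; field.
- by move=> x y; rewrite !lie_vec; apply: vec_inj; rewrite !vecE; ring.
move=> x; rewrite qE qE' form_vec.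
have -> : a' * (s * x 0 (inord 0) + t * x 0 (inord 1)) + b' * x 0 (inord 1) +
  c' * (u * x 0 (inord 2) + v * x 0 (inord 3)) + d' * x 0 (inord 3) =
  (a' * s) * x 0 (inord 0) + (b' + a' * t) * x 0 (inord 1) +
  (c' * u) * x 0 (inord 2) + (d' + c' * v) * x 0 (inord 3) by ring.
rewrite ea eb ec ed.
have -> : l * a * x 0 (inord 0) + l * b * x 0 (inord 1) +
  l * c * x 0 (inord 2) + l * d * x 0 (inord 3) = l * form a b c d x.
  by rewrite /form; ring.
by rewrite mulf_eq0 (negPf l0).
Qed.

Lemma swap_equivalent q q' a b c d : kernel_of q a b c d ->
  kernel_of q' c d a b -> equivalent_subspaces q q'.
Proof.
move=> qE qE'.
pose f (x : two_g21 R) := vec (x 0 (inord 2)) (x 0 (inord 3)) (x 0 (inord 0))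
  (x 0 (inord 1)).
apply: (@automorphism_equivalent f f).
- by move=> k x y; apply: vec_inj; rewrite !mxE ?inordK.
- by move=> x; apply: vec_inj; rewrite !vecE.
- by move=> x; apply: vec_inj; rewrite !vecE.
- by move=> x y; rewrite !lie_vec; apply: vec_inj; rewrite !vecE.
by move=> x; rewrite qE qE' form_vec /form; congr (_ == 0); ring.
Qed.

(** * Normal forms of generating hyperplanes *)

Lemma equivalent_line_class q :
  generating_hyperplane q -> (exists I, contained_line_ideal q I) ->
  forall q0, kernel_of q0 0 1 1 0 -> equivalent_subspaces q q0.
Proof.
move=> /generating_kernel [a [b [c [d [qE nz]]]]].
rewrite (kernel_contains_line_ideal qE) => /eqP ac q0 q0E.
move: ac; rewrite mulf_eq0 => /orP [] /eqP z; rewrite z in qE nz.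
  (* With [a = 0], the products [ac] and [ad] vanish, so [bc] does not. *)
  have b0 : b != 0 by apply/eqP => b0; apply: nz; rewrite b0 !mul0r.
  have c0 : c != 0 by apply/eqP => c0; apply: nz; rewrite c0 !mulr0 !mul0r.
  (* The factor [l] scales [b] to 1; the target has [a' = 0], so [s] and [t] are free. *)
  apply: (triangular_equivalent (l := b^-1) (s := 1) (t := 0) (u := b^-1 * c)
    (v := b^-1 * d) qE q0E); rewrite ?mulf_neq0 ?invr_eq0 ?oner_neq0 //; try ring.
  by rewrite mulVf //; ring.
have d0 : d != 0 by apply/eqP => d0; apply: nz; rewrite d0 !mulr0.
have a0 : a != 0 by apply/eqP => a0; apply: nz; rewrite a0 !mulr0 !mul0r.
(* With [c = 0], the triangular maps reach [(1, 0, 0, 1)], and the exchange of the factors turns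
   this into [(0, 1, 1, 0)]. *)
have [q1 _ q1E] : exists2 q1, \dim q1 = 3%N & kernel_of q1 1 0 0 1.
  apply: (@kernel_hyperplane _ _ _ _ (vec 1 0 0 0)).
  by rewrite form_vec mulr1 !mulr0 !addr0 oner_neq0.
apply: equivalent_trans (swap_equivalent q1E q0E).
apply: (triangular_equivalent (l := d^-1) (s := d^-1 * a) (t := d^-1 * b) (u := 1)
  (v := 0) qE q1E); rewrite ?mulf_neq0 ?invr_eq0 ?oner_neq0 //; try ring.
by rewrite mulVf //; ring.
Qed.

Lemma equivalent_lineless_class q :
  generating_hyperplane q -> ~ (exists I, contained_line_ideal q I) ->
  forall q0, kernel_of q0 1 0 1 0 -> equivalent_subspaces q q0.
Proof.
move=> /generating_kernel [a [b [c [d [qE nz]]]]].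
rewrite (kernel_contains_line_ideal qE) => /eqP; rewrite mulf_eq0 negb_or.
move=> /andP [a0 c0] q0 q0E.
(* These parameters pull [(1, 0, 1, 0)] back to exactly [(a, b, c, d)]; invertibility is [a] and [c]
   being nonzero. *)
by apply: (triangular_equivalent (l := 1) (s := a) (t := b) (u := c) (v := d) qE q0E);
  rewrite ?oner_neq0 //; ring.
Qed.

Lemma kernel_normal_forms : exists q1 q2,
  [/\ kernel_of q1 0 1 1 0, kernel_of q2 1 0 1 0,
      generating_hyperplane q1 & generating_hyperplane q2].
Proof.
have [q1 d1 E1] : exists2 q1, \dim q1 = 3%N & kernel_of q1 0 1 1 0.
  apply: (@kernel_hyperplane _ _ _ _ (vec 0 1 0 0)).
  by rewrite form_vec mulr1 !mulr0 !addr0 !add0r oner_neq0.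
have [q2 d2 E2] : exists2 q2, \dim q2 = 3%N & kernel_of q2 1 0 1 0.
  apply: (@kernel_hyperplane _ _ _ _ (vec 1 0 0 0)).
  by rewrite form_vec mulr1 !mulr0 !addr0 oner_neq0.
exists q1, q2; split=> //.
  apply: (kernel_generating d1 E1) => -[_ _ /eqP].
  by rewrite mulr1 oner_eq0.
apply: (kernel_generating d2 E2) => -[/eqP + _ _].
by rewrite mulr1 oner_eq0.
Qed.

Lemma equivalent_generating q q' : equivalent_subspaces q q' ->
  generating_hyperplane q -> generating_hyperplane q'.
Proof.
move=> e [dq gq]; have dq' := equivalent_dim e; rewrite dq in dq'; split=> //.
move: gq; rewrite !generates_hyperplane ?dq ?dq' ?dim_two_g21 // => nsq sq'.
by apply: nsq; apply: equivalent_subalgebra sq'; apply: equivalent_sym.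
Qed.

(** * The criterion by two-dimensional ideals *)

(** A plane ideal inside [q] would make [q] a subalgebra, so a generating [q] meets each one in a
    line. Conversely, a subalgebra [q] contains one of three coordinate planes that are ideals. *)
Lemma generating_iff_cap q : \dim q = 3%N ->
  generates q <-> (forall J : {vspace two_g21 R}, is_ideal J ->
    \dim J = 2%N -> \dim (q :&: J)%VS = 1%N).
Proof.
move=> dq; have dq4 : (\dim q).+1 = \dim {: two_g21 R} by rewrite dq dim_two_g21.
rewrite generates_hyperplane //; split=> [nsq J iJ dJ | capJ sq].
  apply: dim_hyperplane_cap => //; apply/negP => Jq; apply: nsq.
  by apply: (codim1_ideal_subalgebra iJ Jq); rewrite dq dJ.
(* An ideal spanned by independent [e] and [e'] in [q] meets [q] in dimension two, against
   [capJ]. *)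
have plane (e e' : two_g21 R) : e \in q -> e' \in q -> e' \notin <[e]>%VS ->
    e != 0 -> (forall k k' y, exists l l',
      lie (k *: e + k' *: e') y = l *: e + l' *: e') -> False.
  move=> eq e'q e'e e0 lieE.
  have iJ : is_ideal (<[e]> + <[e']>)%VS.
    move=> x y /memv_addP [_ /vlineP [k ->] [_ /vlineP [k' ->] ->]].
    have [l [l' ->]] := lieE k k' y.
    by rewrite memv_add // memvZ // memv_line.
  have e'0 : e' != 0.
    by apply: contraNneq e'e => ->; exact: mem0v.
  have dJ : \dim (<[e]> + <[e']>)%VS = 2%N.
    rewrite dimv_disjoint_sum ?dim_vline ?e0 ?e'0 //.
    apply/eqP; rewrite -subv0; apply/subvP => x.
    rewrite memv_cap => /andP [xe /vlineP [k xE]].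
    have [k0|k0] := eqVneq k 0; first by rewrite xE k0 scale0r mem0v.
    by move: xe; rewrite xE rpredZeq (negPf k0) (negPf e'e).
  have := capJ _ iJ dJ; rewrite (capv_idPr _) ?dJ //.
  by rewrite subv_add -!memvE eq e'q.
have [a [b [c [d qE]]]] := hyperplane_kernel dq.
have notin i (e e' : two_g21 R) : e 0 i = 0 -> e' 0 i = 1 -> e' \notin <[e]>%VS.
  move=> e0 e1; apply/negP => /vlineP [k e'E]; move/eqP: e1.
  by rewrite e'E mxE e0 mulr0 eq_sym oner_eq0.
have nz i (e : two_g21 R) : e 0 i = 1 -> e != 0.
  by move=> e1; apply/eqP => e0; move/eqP: e1; rewrite e0 mxE eq_sym oner_eq0.
have plane02 : a = 0 -> c = 0 -> False.
  move=> z z'.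
  apply: (plane (vec 1 0 0 0) (vec 0 0 1 0)).
  - by rewrite qE form_vec z z'; apply/eqP; ring.
  - by rewrite qE form_vec z z'; apply/eqP; ring.
  - by apply: (notin (inord 2)); rewrite vecE.
  - by apply: (nz (inord 0)); rewrite vecE.
  move=> k k' y; exists (k * y 0 (inord 1)), (k' * y 0 (inord 3)).
  by rewrite lie_vec !scale_vec; apply: vec_inj; rewrite !mxE !inordK //=; ring.
move/(kernel_subalgebra qE): sq => [/eqP + /eqP ad /eqP].
rewrite mulf_eq0 => /orP [] /eqP z.
  rewrite mulf_eq0 => /orP [] /eqP z'.
    (* Here [a = b = 0], and [q] contains the first factor [<E1, E2>]. *)
    apply: (plane (vec 1 0 0 0) (vec 0 1 0 0)).
    - by rewrite qE form_vec z z'; apply/eqP; ring.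
    - by rewrite qE form_vec z z'; apply/eqP; ring.
    - by apply: (notin (inord 1)); rewrite vecE.
    - by apply: (nz (inord 0)); rewrite vecE.
    move=> k k' y; exists (k * y 0 (inord 1) - k' * y 0 (inord 0)), 0.
    by rewrite lie_vec !scale_vec; apply: vec_inj; rewrite !mxE !inordK //=; ring.
  exact: plane02.
move=> _; move: ad; rewrite mulf_eq0 => /orP [] /eqP z'; first exact: plane02.
(* Here [c = d = 0], and [q] contains the second factor [<E3, E4>]. *)
apply: (plane (vec 0 0 1 0) (vec 0 0 0 1)).
- by rewrite qE form_vec z z'; apply/eqP; ring.
- by rewrite qE form_vec z z'; apply/eqP; ring.
- by apply: (notin (inord 3)); rewrite vecE.
- by apply: (nz (inord 2)); rewrite vecE.
move=> k k' y; exists (k * y 0 (inord 3) - k' * y 0 (inord 2)), 0.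
by rewrite lie_vec !scale_vec; apply: vec_inj; rewrite !mxE !inordK //=; ring.
Qed.

End TwoG21Hyperplanes.

(** * The generation criterion together with the two equivalence classes *)

Theorem proposition14 (R : realType) :
  (forall q : {vspace two_g21 R}, \dim q = 3%N ->
     (generates q <->
      (forall J : {vspace two_g21 R}, is_ideal J -> \dim J = 2%N ->
         \dim (q :&: J)%VS = 1%N)))
  /\
  (exists C1 C2 : set {vspace two_g21 R},
     [/\ C1 <> C2,
         [set equivalence_class q | q in @generating_hyperplane R]%classic
           = [set C1; C2]%classic &
         forall q : {vspace two_g21 R}, generating_hyperplane q ->
           (C1 q <-> (exists! I : {vspace two_g21 R}, contained_line_ideal q I))
           /\
           (C2 q <->
              ~ (exists I : {vspace two_g21 R}, contained_line_ideal q I))]).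
Proof.
split=> [q dq|]; first exact: generating_iff_cap.
have [q1 [q2 [E1 E2 g1 g2]]] := kernel_normal_forms R.
have line1 : exists I, contained_line_ideal q1 I.
  by rewrite (kernel_contains_line_ideal E1) mul0r.
have line2 : ~ exists I, contained_line_ideal q2 I.
  by rewrite (kernel_contains_line_ideal E2) mulr1 => /eqP; rewrite oner_eq0.
(* Automorphisms carry line ideals to line ideals; conversely, [q] is equivalent to its normal
   form. *)
have class1 q : generating_hyperplane q ->
    equivalence_class q1 q <-> exists I, contained_line_ideal q I.
  move=> gq; split=> [e | lq]; first exact: equivalent_line_ideal e line1.
  by apply: equivalent_sym; exact: equivalent_line_class lq _ E1.
have class2 q : generating_hyperplane q ->
    equivalence_class q2 q <-> ~ exists I, contained_line_ideal q I.
  move=> gq; split=> [e lq | lq].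
    by apply: line2; apply: equivalent_line_ideal lq; exact: equivalent_sym.
  by apply: equivalent_sym; exact: equivalent_lineless_class lq _ E2.
have class_eq (q q' : {vspace two_g21 R}) :
    equivalent_subspaces q q' -> equivalence_class q = equivalence_class q'.
  move=> e; apply/seteqP; split=> x /= h; last exact: equivalent_trans e h.
  by apply: equivalent_trans h; exact: equivalent_sym.
exists (equivalence_class q1), (equivalence_class q2); split.
(* If the classes coincided, [q2] would lie in the class of [q1] and contain a line ideal. *)
- move=> e; apply: (line2); apply/(class1 q2 g2); rewrite e.
  exact/(class2 q2 g2).
- apply/seteqP; split=> [C [q gq <-] | C [] ->]; [ | by exists q1 | by exists q2].
  have [lq | lq] := pselect (exists I, contained_line_ideal q I).
    by left; apply: class_eq; exact: equivalent_line_class lq _ E1.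
  by right; apply: class_eq; exact: equivalent_lineless_class lq _ E2.
move=> q gq; rewrite -(unique_line_ideal gq); split; [exact: class1 | exact: class2].
Qed.
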